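(* Let $\zeta\in\mathbb{C}^n$ and let $S_1,S_2$ be two algebraically restricted systems of differential equations with $\mathfrak{Sol}_\zeta(S_1)\subseteq\mathfrak{Sol}_\zeta(S_2)$ such that counting sequences $c(S_1)$ and $c(S_2)$ exist. If there exist an $\ell\in\mathbb{Z}_{\ge0}$ and $q_1,q_2\in\mathbb{Z}[\infty]$ with $c(S_1)(\ell)\prec q_1$, $q_1<q_2$ (strictly), and $c(S_2)(\ell)\succ q_2$, then $\mathfrak{Sol}_\zeta(S_1)\neq\mathfrak{Sol}_\zeta(S_2)$.
   Context: **Order and estimates.** For $q,q'\in\mathbb{Q}[\infty]$ write $q<q'$ if there exists $x_0$ with $q(x)<q'(x)$ for all real $x>x_0$. For $p(\aleph_0,\infty)\in\mathbb{Z}[\aleph_0,\infty]$ and $q(\infty)\in\mathbb{Z}[\infty]$ write $p\prec q$ if $p(k,\infty)=q(\infty)$ for some $k\in\mathbb{Z}_{\ge0}$ (enlarging: a countably infinite exceptional set is replaced by a finite one), and $p\succ q$ if $p(\infty-k,\infty)=q(\infty)$ for some $k\in\mathbb{Z}_{\ge0}$ (shrinking: a set $\mathbb{C}\setminus M$ with $M$ countably infinite is replaced by a finite set). **Algebraic counting polynomials.** Let $\pi_i:\mathbb{C}^N\to\mathbb{C}^i$, $(a_1,\ldots,a_N)\mapsto(a_1,\ldots,a_i)$. Let $\infty,\aleph_0$ be free indeterminates. For $V\subseteq\mathbb{C}^N$, any element $c(V)\in\mathbb{Z}[\infty,\aleph_0]$ constructed by iteratively (finitely often) applying the following five axioms is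 called an algebraic counting polynomial of $V$ (it need not exist or be unique): (1) $c(V)=|V|$ if $V$ is finite; (2) $c(V)=\infty$ if $V$ is an affine $1$-space over $\mathbb{C}$; (3) $c(V\uplus W)=c(V)+c(W)$ for disjoint $V,W$; (4) if for some $i$ each non-empty fiber $W$ of $\pi_i|_V$ has the same value under $c$, then $c(V)=c(W)\cdot c(\pi_i(V))$ (fibers are viewed as subsets of $\mathbb{C}^{N-i}$); (5) $c(\mathbb{C}^1\setminus M)=\infty-\aleph_0$ for countably infinite $M\subset\mathbb{C}^1$. **Differential setting.** $F\supseteq\mathbb{C}$ is a field of meromorphic functions in $n$ complex variables $x_1,\ldots,x_n$, $\Delta=\{\partial_{x_1},\ldots,\partial_{x_n}\}$, $U=\{u^{(1)},\ldots,u^{(m)}\}$ is a set of differential indeterminates, $u^{(j)}_\mu=\partial^\mu u^{(j)}$ for $\mu\in\mathbb{Z}_{\ge0}^n$, and $F\{U\}$ is the differential polynomial ring, i.e. the polynomial ring over $F$ in all $u^{(j)}_\mu$. An orderly ranking $<$ is fixed: a total order of the $u^{(j)}_\mu$ with $u^{(j)}_\mu<\partial u^{(j)}_\mu$, with $u^{(j)}_\mu<u^{(j')}_{\mu'}\Rightarrow\partial u^{(j)}_\mu<\partial u^{(j')}_{\mu'}$ for $\partial\in\Delta$, and with $|\mu|<|\mu'|\Rightarrow u^{(j)}_\mu<u^{(j')}_{\mu'}$, where $|\mu|=\mu_1+\ldots+\mu_n$. Let $G=\{g^{(j)}_\mu\mid\mu\in\mathbb{Z}_{\ge0}^n,1\le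 j\le m\}$ be indeterminates, ordered via $u^{(j)}_\mu\leftrightarrow g^{(j)}_\mu$; $\mathbb{C}[G]$ is the polynomial ring of power series coefficients and $\mathbb{C}[G]_{\le\ell}$ the subring generated by the $g^{(j)}_\mu$ with $|\mu|\le\ell$. An algebraically restricted system of differential equations is a finite union of differential equations $p=0$ with $p\in F\{U\}$, equations in $\mathbb{C}[G]$, and inequations ($\ne0$) in $\mathbb{C}[G]$. For $\zeta\in\mathbb{C}^n$ at which the coefficients of the differential equations are holomorphic, let $P_\zeta=\mathbb{C}[[x_1-\zeta_1,\ldots,x_n-\zeta_n]]$. $\mathfrak{Sol}_\zeta(S)\subseteq P_\zeta^U$ is the set of tuples $f$ of formal power series solving all differential equations of $S$ (in the usual sense) and such that each equation (inequation) of $S$ in $\mathbb{C}[G]$ evaluates to zero (non-zero) when $g^{(j)}_\mu$ is replaced by the coefficient of $(x_1-\zeta_1)^{\mu_1}\cdots(x_n-\zeta_n)^{\mu_n}$ in $f(u^{(j)})$. $\mathfrak{Sol}_\zeta(S)_{\le\ell}$ is the image of $\mathfrak{Sol}_\zeta(S)$ in $P_\zeta^U/P_{\zeta,>\ell}^U$, where $P_{\zeta,>\ell}^U$ is the submodule generated by the monomials of total degree $>\ell$ in each component; the quotient is identified with the affine space with coordinates $g^{(j)}_\mu$, $|\mu|\le\ell$, ordered by the ranking. **Counting sequence.** An $\ell$-th differential counting polynomial of $S$ is an algebraic counting polynomial in $\mathbb{Z}[\infty,\aleph_0]$ of $\mathfrak{Sol}_\zeta(S)_{\le\ell}$ (written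 as a countable disjoint union of solution sets of algebraic systems of finitely many equations and countably many inequations in $\mathbb{C}[G]_{\le\ell}$), if one exists. If an $\ell$-th differential counting polynomial $c(S)(\ell)$ exists for all $\ell\in\mathbb{Z}_{\ge0}$, the sequence $c(S):\ell\mapsto c(S)(\ell)$ is a counting sequence of $S$. *)

(* Defs.v *)
From HB Require Import structures.
From mathcomp Require Import all_boot all_order all_algebra.
From mathcomp Require Import finmap.
From mathcomp Require Import all_classical all_reals all_analysis.
From mathcomp Require Import complex.
From mathcomp Require Import -(notations) mpoly.
From mathcomp Require Import -(notations) monalg.

Set Implicit Arguments.
Unset Strict Implicit.
Unset Printing Implicit Defensive.

Import Order.TTheory GRing.Theory Num.Theory.
Import numFieldNormedType.Exports.

Local Open Scope classical_set_scope.
Local Open Scope ring_scope.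

(* Everything is stated over an arbitrary numFieldType K, which MathComp-Analysis
   equips with the topology of its norm; the intended K is R[i], R : realType. *)

Section EventualOrder.
Variable R : realType.

Definition eventually_lt (q q' : {poly rat}) : Prop :=
  exists x0 : R, forall x : R, x0 < x ->
    (map_poly ratr q).[x] < (map_poly ratr q').[x].

End EventualOrder.

(* Z[oo, aleph_0] as Z[oo][aleph_0]: oo is the inner variable, aleph_0 the
   outer one, so p.[q] substitutes q for aleph_0. *)
Notation cpoly := {poly {poly int}}.
Notation cp_infty := (('X : {poly int})%:P : cpoly).
Notation cp_aleph := ('X : cpoly).

Definition cp_prec (p : cpoly) (q : {poly int}) : Prop :=
  exists k : nat, p.[k%:R] = q.

Definition cp_succ (p : cpoly) (q : {poly int}) : Prop :=
  exists k : nat, p.['X - k%:R] = q.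

Section AlgebraicCounting.
Variable K : numFieldType.

Definition affine_line N (V : set 'rV[K]_N) : Prop :=
  exists a d : 'rV[K]_N, d != 0 /\ V = [set a + t *: d | t in [set: K]].

(* [acp V p]: p is an algebraic counting polynomial of V.

   The additivity axiom c(V + W) = c(V) + c(W) is used in two ways: to compute
   c(V + W) (acp_union), and, when W is finite, to solve for c(V) (acp_diff).
   The latter gives c(C \ {0}) = oo - 1, and with it the counting polynomial of
   every constructible set.  Solving for c(V) cannot be allowed for arbitrary W:
   it would give c(M) = c(C) - c(C \ M) = aleph_0 for every countably infinite
   M, hence also c(M) = 2 aleph_0, and c(C) = oo + aleph_0, which is compatible
   neither with the enlarging reading of cp_prec nor with the shrinking reading
   of cp_succ. *)
Inductive acp : forall N : nat, set 'rV[K]_N -> cpoly -> Prop :=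
| acp_finite N (A : {fset 'rV[K]_N}) : acp [set` A] (#|` A|%fset)%:R
| acp_line N (V : set 'rV[K]_N) : affine_line V -> acp V cp_infty
| acp_union N (V W : set 'rV[K]_N) p q :
    V `&` W = set0 -> acp V p -> acp W q -> acp (V `|` W) (p + q)
| acp_diff N (V : set 'rV[K]_N) (A : {fset 'rV[K]_N}) p :
    V `&` [set` A] = set0 -> acp (V `|` [set` A]) p ->
    acp V (p - (#|` A|%fset)%:R)
| acp_fibration i k (V : set 'rV[K]_(i + k)) p q :
    (forall a : 'rV[K]_i, (lsubmx @` V) a ->
       acp [set w : 'rV[K]_k | V (row_mx a w)] p) ->
    acp (lsubmx @` V) q -> acp V (p * q)
| acp_cocountable (M : set 'rV[K]_1) :
    countable M -> infinite_set M -> acp (~` M) (cp_infty - cp_aleph).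

(* Finite unions and finitely many inequations are covered by padding with the
   inconsistent system 1 = 0 and the inequation 1 <> 0. *)
Definition countable_constructible N (V : set 'rV[K]_N) : Prop :=
  exists (eqs : nat -> seq (mpoly N K)) (ineqs : nat -> nat -> mpoly N K),
    let piece k := [set a : 'rV[K]_N |
      (forall p, p \in eqs k -> meval (fun i => a ord0 i) p = 0) /\
      (forall l, meval (fun i => a ord0 i) (ineqs k l) <> 0)] in
    trivIset setT piece /\ V = \bigcup_k piece k.

End AlgebraicCounting.

Section PowerSeries.
Variables (K : numFieldType) (n : nat).

(* A formal power series, in x - zeta for a zeta left implicit. *)
Definition pseries : Type := multinom n -> K.

Definition ps_one : pseries := fun nu => (nu == mnm0)%:R.

Definition ps_mul (f g : pseries) : pseries := fun nu =>
  \sum_(mu : bmultinom n (mpoly.mdeg nu).+1 | lem mu nu)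
     f mu * g (mnm_sub nu mu).

Definition ps_exp (f : pseries) (k : nat) : pseries := iter k (ps_mul f) ps_one.

Definition ps_deriv (mu : multinom n) (f : pseries) : pseries := fun nu =>
  (\prod_(i < n) ((nu i + mu i) ^_ (mu i))%N)%:R * f (mnm_add nu mu).

Definition ps_partial_sum (a : pseries) (z w : 'rV[K]_n) (k : nat) : K :=
  \sum_(mu : bmultinom n k) a mu * \prod_(i < n) (w ord0 i - z ord0 i) ^+ mu i.

(* [ball z r] is the open polydisc of polyradius (r, ..., r); the bound on the
   coefficients makes the convergence absolute there. *)
Definition power_series_on (z : 'rV[K]_n) (r : K) (a : pseries)
    (h : 'rV[K]_n -> K) : Prop :=
  [/\ 0 < r,
      exists B : K, forall mu, `|a mu| * r ^+ mpoly.mdeg mu <= B &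
      forall w, ball z r w -> ps_partial_sum a z w @ \oo --> h w].

Definition holomorphic_on (D : set 'rV[K]_n) (h : 'rV[K]_n -> K) : Prop :=
  forall z, D z -> exists r a, power_series_on z r a h.

(* Equality of meromorphic functions on the open set D: equality of their
   values on a dense open subset.  Values at poles are irrelevant. *)
Definition generically_eq (D : set 'rV[K]_n) (h h' : 'rV[K]_n -> K) : Prop :=
  D `<=` closure (interior [set w | h w = h' w]).

Definition meromorphic_on (D : set 'rV[K]_n) (h : 'rV[K]_n -> K) : Prop :=
  forall z, D z -> exists r (g d : 'rV[K]_n -> K),
    [/\ 0 < r, holomorphic_on (ball z r) g, holomorphic_on (ball z r) d,
        exists2 w, ball z r w & d w <> 0 &
        generically_eq (ball z r) (fun w => d w * h w) g].

(* The meromorphic function h on D is holomorphic at z, with Taylor series a. *)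
Definition taylor_expansion (D : set 'rV[K]_n) (h : 'rV[K]_n -> K)
    (z : 'rV[K]_n) (a : pseries) : Prop :=
  exists r h', [/\ ball z r `<=` D, power_series_on z r a h' &
                   generically_eq (ball z r) h h'].

End PowerSeries.

(* A differential field of meromorphic functions on a domain of K^n, containing
   the constants. *)
Record merofield (K : numFieldType) (n : nat) := MeroField {
  mf_sort :> fieldType;
  mf_dom : set 'rV[K]_n;
  mf_fun : mf_sort -> 'rV[K]_n -> K;
  mf_dom_open : open mf_dom;
  mf_dom_connected : connected mf_dom;
  mf_dom_neq0 : mf_dom !=set0;
  mf_mero : forall f, meromorphic_on mf_dom (mf_fun f);
  mf_one : generically_eq mf_dom (mf_fun 1) (fun=> 1);
  mf_add : forall f g,
    generically_eq mf_dom (mf_fun (f + g)) (fun w => mf_fun f w + mf_fun g w);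
  mf_mul : forall f g,
    generically_eq mf_dom (mf_fun (f * g)) (fun w => mf_fun f w * mf_fun g w);
  mf_const : forall c : K, exists f, generically_eq mf_dom (mf_fun f) (fun=> c);
  mf_deriv : forall f (i : 'I_n), exists g, forall z a,
    taylor_expansion mf_dom (mf_fun f) z a ->
    taylor_expansion mf_dom (mf_fun g) z (ps_deriv (mnm1 i) a)
}.

(* The index (j, mu) stands for u^(j)_mu as well as for g^(j)_mu. *)
Definition jetvar (m n : nat) : choiceType := ('I_m * multinom n)%type.

Definition jet_shift m n (i : 'I_n) (v : jetvar m n) : jetvar m n :=
  (v.1, mnm_add v.2 (mnm1 i)).

Record orderly_ranking m n (lt : rel (jetvar m n)) : Prop := OrderlyRanking {
  rk_irrefl : irreflexive lt;
  rk_trans : transitive lt;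
  rk_total : forall v w, v != w -> lt v w || lt w v;
  rk_shift : forall i v, lt v (jet_shift i v);
  rk_compat : forall i v w, lt v w -> lt (jet_shift i v) (jet_shift i w);
  rk_orderly : forall v w : jetvar m n,
    (mpoly.mdeg v.2 < mpoly.mdeg w.2)%N -> lt v w
}.

(* The variables of order at most l, in increasing order. *)
Definition jets_upto m n (lt : rel (jetvar m n)) (l : nat) : seq (jetvar m n) :=
  sort (fun v w => (v == w) || lt v w)
    [seq (j, bmnm mu) | j <- enum 'I_m, mu <- enum {: bmultinom n l.+1}].

Section Systems.
Variables (K : numFieldType) (m n : nat).

(* The polynomial ring A[g^(j)_mu], or A[u^(j)_mu]. *)
Definition jetpoly (A : nzRingType) := malg (cmonom (jetvar m n)) A.

(* The support of a monomial, i.e. the variables dividing it. *)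
Definition mon_supp (M : cmonom (jetvar m n)) : seq (jetvar m n) :=
  finsupp (cmonom_val M).

Definition jet_eval (x : jetvar m n -> K) (p : jetpoly K) : K :=
  mmap idfun (fun M => \prod_(v <- mon_supp M) x v ^+ M v) p.

Variable F : merofield K n.

Definition holomorphic_at (f : F) (z : 'rV[K]_n) : Prop :=
  exists a, taylor_expansion (mf_dom F) (mf_fun f) z a.

Definition taylor (z : 'rV[K]_n) (f : F) : pseries K n :=
  xget (fun=> 0) [set a | taylor_expansion (mf_dom F) (mf_fun f) z a].

(* The value of the differential polynomial p at the tuple f of formal power
   series in x - z. *)
Definition diff_eval (z : 'rV[K]_n) (p : jetpoly F) (f : 'I_m -> pseries K n) :
    pseries K n := fun nu =>
  \sum_(M <- msupp p)
    ps_mul (taylor z (mcoeff M p))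
      (\big[@ps_mul K n/@ps_one K n]_(v <- mon_supp M)
         ps_exp (ps_deriv v.2 (f v.1)) (M v)) nu.

Record ar_system := ARSystem {
  ar_deqs : seq (jetpoly F);
  ar_eqs : seq (jetpoly K);
  ar_ineqs : seq (jetpoly K)
}.

Definition holomorphic_coeffs (S : ar_system) (z : 'rV[K]_n) : Prop :=
  forall p M, p \in ar_deqs S -> M \in msupp p ->
    holomorphic_at (mcoeff M p) z.

Definition Sol (z : 'rV[K]_n) (S : ar_system) : set ('I_m -> pseries K n) :=
  [set f | [/\ forall p, p \in ar_deqs S -> diff_eval z p f = (fun=> 0),
               forall p, p \in ar_eqs S -> jet_eval (fun v => f v.1 v.2) p = 0 &
               forall p, p \in ar_ineqs S ->
                 jet_eval (fun v => f v.1 v.2) p <> 0]].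

End Systems.

(* The image of Sol modulo the monomials of degree > l, as a subset of the affine
   space whose i-th coordinate is the i-th smallest variable of order <= l. *)
Definition Sol_upto (K : numFieldType) (m n : nat) (F : merofield K n)
    (lt : rel (jetvar m n)) (z : 'rV[K]_n) (S : ar_system m F) (l : nat) :
    set 'rV[K]_(size (jets_upto lt l)) :=
  [set (\row_i let v := tnth (in_tuple (jets_upto lt l)) i in f v.1 v.2)
  | f in Sol z S].
Arguments Sol_upto {K m n F} lt z S l.

Definition diff_counting_poly (K : numFieldType) (m n : nat) (F : merofield K n)
    (lt : rel (jetvar m n)) (z : 'rV[K]_n) (S : ar_system m F) (l : nat)
    (p : cpoly) : Prop :=
  countable_constructible (Sol_upto lt z S l) /\ acp (Sol_upto lt z S l) p.

Definition counting_sequence (K : numFieldType) (m n : nat) (F : merofield K n)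
    (lt : rel (jetvar m n)) (z : 'rV[K]_n) (S : ar_system m F)
    (c : nat -> cpoly) : Prop :=
  forall l, diff_counting_poly lt z S l (c l).

(* Main.v *)
Require Import Defs.
From HB Require Import structures.
From mathcomp Require Import all_boot all_order all_algebra.
From mathcomp Require Import finmap.
From mathcomp Require Import all_classical all_reals all_analysis.
From mathcomp Require Import complex.
From mathcomp Require Import zify.

(** Replace the line K by a finite set of e points, chosen anew below every point
    already chosen: a finite tree of arity e in K^N, whose leaves are counted
    inside V.  Prescribing finitely many points at every node of the tree forces
    it to meet each countably infinite set M in at least k points and each
    complement of such an M in at least k' points.  Then an algebraic counting
    polynomial p of V bounds the number x of leaves in V by
    p(oo - k', e) <= x <= p(k, e).  Prescriptions can be combined, so two
    counting polynomials of the same V are compared on a common tree, for every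
    large e. *)

Set Implicit Arguments.
Unset Strict Implicit.
Unset Printing Implicit Defensive.

Import Order.TTheory GRing.Theory Num.Theory.
Local Open Scope classical_set_scope.
Local Open Scope ring_scope.

(** * Finite trees of constant arity with prescribed children *)

Section Trees.
Variable T : choiceType.
Implicit Types (R E : seq T -> seq T) (s t : seq T).

(* A tree is given by the list E s of the children of each node s, a node being
   the path leading to it; values off the tree are irrelevant. *)
Fixpoint leaves N E : seq (seq T) :=
  if N is N'.+1 then
    [seq a :: s | a <- E [::], s <- leaves N' (fun t => E (a :: t))]
  else [:: [::]].

(** [R] is the prescription. Its lists may be longer than [e], so for small [e] there may be no such
    tree. *)
Fixpoint tree_over e R E N : Prop :=
  if N is N'.+1 then
    [/\ uniq (E [::]), size (E [::]) = e, {subset R [::] <= E [::]} &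
        forall a, a \in E [::] ->
          tree_over e (fun t => R (a :: t)) (fun t => E (a :: t)) N']
  else True.

Lemma leaves_size N E s : s \in leaves N E -> size s = N.
Proof.
elim: N E s => [|N IH] E s /=; first by rewrite inE => /eqP ->.
by case/allpairsPdep => a [t] [_ /IH <- ->].
Qed.

Lemma leaves_uniq e R E N : tree_over e R E N -> uniq (leaves N E).
Proof.
elim: N R E => [//|N IH] R E [uE _ _ sub] /=.
apply: allpairs_uniq_dep => // [a aE|]; first exact: IH (sub a aE).
by move=> [a s] [b t] _ _ /= [-> ->].
Qed.

Lemma tree_over_sub e R R' E N : (forall s, {subset R s <= R' s}) ->
  tree_over e R' E N -> tree_over e R E N.
Proof.
elim: N R R' E => [//|N IH] R R' E sRR' [uE sE sub ch]; split=> //.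
  by move=> a /sRR' /sub.
by move=> a /ch; apply: IH => s; apply: sRR'.
Qed.

Lemma tree_over_catr e R1 R2 E N :
  tree_over e (fun s => R1 s ++ R2 s) E N ->
  tree_over e R1 E N /\ tree_over e R2 E N.
Proof.
move=> h; split.
  by refine (tree_over_sub _ h) => s a aR; rewrite mem_cat aR.
by refine (tree_over_sub _ h) => s a aR; rewrite mem_cat aR orbT.
Qed.

(** The subtrees hanging from the leaves of depth [i] serve to count the fibers of the projection to
    the first [i] coordinates. *)
Lemma tree_over_cat e R E i k : tree_over e R E (i + k) ->
  tree_over e R E i /\
  forall s, s \in leaves i E ->
    tree_over e (fun t => R (s ++ t)) (fun t => E (s ++ t)) k.
Proof.
elim: i R E => [|i IH] R E.
  by rewrite add0n => h; split=> // s; rewrite inE => /eqP ->.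
rewrite addSn => -[uE sE sub ch]; split.
  by split=> // a /ch /IH [].
by move=> s /allpairsPdep [a] [t] [/ch /IH [_ h] /h + ->].
Qed.

Lemma sum_leaves_cat E i k (f : seq T -> nat) :
  (\sum_(s <- leaves (i + k) E) f s =
   \sum_(s <- leaves i E) \sum_(t <- leaves k (fun t => E (s ++ t)))
      f (s ++ t))%N.
Proof.
elim: i E f => [|i IH] E f; first by rewrite add0n big_seq1.
rewrite addSn /= !big_allpairs_dep /=; apply: eq_bigr => a _.
by rewrite (IH _ (fun s => f (a :: s))).
Qed.

Lemma mem_leaves (x0 : T) e R E x :
  (forall s, nth x0 x (size s) \in R s) -> tree_over e R E (size x) ->
  x \in leaves (size x) E.
Proof.
elim: x R E => [|b x IH] R E //= hR [uE sE sub ch].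
apply/allpairsPdep; exists b, x; split=> //; first exact/sub/(hR [::]).
by apply: IH (ch b _) => [s|]; [exact: (hR (b :: s)) | exact/sub/(hR [::])].
Qed.

(* The children of a node may need an arity which depends on the child; since
   T is uncountable, infinitely many of them share one bound, and a node can
   be filled up with those. *)
Lemma tree_over_exists R N : ~ countable [set: T] ->
  exists e0, forall e, (e0 <= e)%N -> exists E, tree_over e R E N.
Proof.
move=> uncT; elim: N R => [|N IH] R; first by exists 0%N => e _; exists R.
have /choice[e0 he0] a := IH (fun t => R (a :: t)).
have [n infn] : exists n, infinite_set [set a | (e0 a <= n)%N].
  apply: contrapT => /forallNP fin; apply: uncT.
  have -> : [set: T] = \bigcup_n [set a | (e0 a <= n)%N].
    by apply/seteqP; split=> // a _; exists (e0 a) => /=.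
  apply: bigcup_countable => // n _.
  by apply: finite_set_countable; apply: contrapT (fin n).
set A := undup (R [::]).
(* The three terms provide, in turn, for the subtrees below the fillers, for room to hold the
   prescribed children [A], and for the subtrees below these. *)
exists (maxn n (maxn (size A) (\max_(a <- A) e0 a))) => e.
rewrite !geq_max => /and3P[ne Ae /bigmax_leqP_seq e0e].
have infD : infinite_set ([set a | (e0 a <= n)%N] `\` [set` A]).
  by apply: infinite_setD.
have [B sB cB] := infinite_set_fset (e - size A) infD.
pose X := A ++ take (e - size A) B.
have Xe a : a \in X -> (e0 a <= e)%N.
  rewrite mem_cat => /orP[/e0e->//|/mem_take/sB[/= h _]].
  exact: leq_trans h ne.
have /choice[Ec hEc] a : exists E', a \in X ->
    tree_over e (fun t => R (a :: t)) E' N.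
  case aX : (a \in X); last by exists R.
  by have [E' ?] := he0 a e (Xe a aX); exists E'.
exists (fun s => if s is a :: t then Ec a t else X); split.
- rewrite cat_uniq undup_uniq take_uniq ?fset_uniq // andbT /=.
  by apply/hasPn => a /mem_take /sB [_ /= /negP].
- by rewrite size_cat size_takel // subnKC.
- by move=> a aR; rewrite mem_cat mem_undup aR.
- by move=> a aX; apply: hEc.
Qed.

End Trees.

(** * Sums with uniformly bounded terms *)

Section SumBounds.
Variables (I : eqType) (r : seq I) (a : pred I) (f : I -> nat) (P : int).

(** Stated over the integers because values at the shrinking end may be negative. *)
Lemma ler_sum_count : (forall i, i \in r -> a i -> P <= (f i)%:Z) ->
  (count a r)%:Z * P <= (\sum_(i <- r | a i) f i)%:Z.
Proof.
elim: r => [|i s IH] h; first by rewrite big_nil mul0r.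
have {IH} : (count a s)%:Z * P <= (\sum_(j <- s | a j) f j)%:Z.
  by apply: IH => j js; apply: h; rewrite inE js orbT.
rewrite big_cons /=; case: ifP => // ai; have := h i (mem_head _ _) ai.
by rewrite !PoszD; lia.
Qed.

Lemma ger_sum_count : (forall i, i \in r -> a i -> (f i)%:Z <= P) ->
  (\sum_(i <- r | a i) f i)%:Z <= (count a r)%:Z * P.
Proof.
elim: r => [|i s IH] h; first by rewrite big_nil mul0r.
have {IH} : (\sum_(j <- s | a j) f j)%:Z <= (count a s)%:Z * P.
  by apply: IH => j js; apply: h; rewrite inE js orbT.
rewrite big_cons /=; case: ifP => // ai; have := h i (mem_head _ _) ai.
by rewrite !PoszD; lia.
Qed.

End SumBounds.

(** * Leaves as points of affine space, and their number in a set *)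

Section LeafCount.
Variable K : numFieldType.
Implicit Types (R E : seq K -> seq K) (s t : seq K).

Definition row_of_seq N s : 'rV[K]_N := \row_i s`_i.

Lemma row_of_seq_inj N :
  {in [pred s | size s == N] &, injective (@row_of_seq N)}.
Proof.
move=> s t /eqP sN /eqP tN /rowP st; apply: (@eq_from_nth _ 0); rewrite sN//.
by move=> i iN; have := st (Ordinal iN); rewrite !mxE.
Qed.

Lemma row_of_seq_cat i k s t : size s = i ->
  row_of_seq (i + k) (s ++ t) = row_mx (row_of_seq i s) (row_of_seq k t).
Proof.
move=> si; apply/rowP => j; rewrite !mxE nth_cat si.
case: splitP => j' ->; rewrite mxE //.
by rewrite addKn.
Qed.

Definition rows N E : seq 'rV[K]_N := [seq row_of_seq N s | s <- leaves N E].

Lemma rows_uniq e R E N : tree_over e R E N -> uniq (rows N E).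
Proof.
move=> /leaves_uniq uE; rewrite map_inj_in_uniq // => s t /leaves_size sN.
by move=> /leaves_size tN; apply: row_of_seq_inj; rewrite inE ?sN ?tN.
Qed.

(** Every node of depth [j] is prescribed the [j]-th coordinates of all points of [A], so one
    prescription serves every arity and every tree. *)
Lemma mem_rows N (A : {fset 'rV[K]_N}) : exists R, forall e E,
  tree_over e R E N -> {subset A <= rows N E}.
Proof.
pose sq (v : 'rV[K]_N) := [seq v ord0 i | i <- enum 'I_N].
have sqN v : size (sq v) = N by rewrite size_map size_enum_ord.
exists (fun s => [seq (sq v)`_(size s) | v <- A]) => e E hE v vA.
apply/mapP; exists (sq v); last first.
  by apply/rowP => i; rewrite mxE (nth_map i) ?size_enum_ord // nth_ord_enum.
rewrite -{1}[N](sqN v); apply: (mem_leaves (x0 := 0)) => [s|]; last first.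
  by rewrite sqN; exact: hE.
by apply/mapP; exists v.
Qed.

Definition leaf_count N E (V : set 'rV[K]_N) : nat :=
  count (fun v => `[< V v >]) (rows N E).

Lemma leaf_countE N E (V : set 'rV[K]_N) :
  leaf_count E V =
  (\sum_(s <- leaves N E) (`[< V (row_of_seq N s) >] : nat))%N.
Proof.
rewrite /leaf_count -sum1_count big_mkcond big_map.
by apply: eq_bigr => s _; case: asbool.
Qed.

Lemma leaf_count_ge e R E N (A : {fset 'rV[K]_N}) (V : set 'rV[K]_N) :
  tree_over e R E N -> {subset A <= rows N E} -> [set` A] `<=` V ->
  (#|` A| <= leaf_count E V)%N.
Proof.
move=> hE AE AV; rewrite /leaf_count -size_filter.
apply: uniq_leq_size => [|v vA]; first exact: fset_uniq.
by rewrite mem_filter AE // andbT; apply/asboolP/AV.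
Qed.

Lemma leaf_count_fset e R E N (A : {fset 'rV[K]_N}) :
  tree_over e R E N -> {subset A <= rows N E} ->
  leaf_count E [set` A] = #|` A|.
Proof.
move=> hE AE; apply/eqP; rewrite eqn_leq (leaf_count_ge hE AE) // andbT.
rewrite /leaf_count -size_filter; apply: uniq_leq_size.
  by rewrite filter_uniq // (rows_uniq hE).
by move=> v; rewrite mem_filter => /andP[/asboolP].
Qed.

Lemma leaf_countU E N (V W : set 'rV[K]_N) : V `&` W = set0 ->
  leaf_count E (V `|` W) = (leaf_count E V + leaf_count E W)%N.
Proof.
move=> VW; rewrite !leaf_countE -big_split; apply: eq_bigr => s _ /=.
rewrite asbool_or; case: asboolP => //= Vs; case: asboolP => //= Ws.
by have : (V `&` W) (row_of_seq N s) by []; rewrite VW.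
Qed.

Lemma leaf_count_fibration E i k (V : set 'rV[K]_(i + k)) :
  leaf_count E V =
  (\sum_(s <- leaves i E | `[< (lsubmx @` V) (row_of_seq i s) >])
     leaf_count (fun t => E (s ++ t))
       [set w : 'rV[K]_k | V (row_mx (row_of_seq i s) w)])%N.
Proof.
rewrite leaf_countE sum_leaves_cat [RHS]big_mkcond big_seq [RHS]big_seq.
apply: eq_bigr => s /leaves_size si.
have -> : (\sum_(t <- leaves k (fun t => E (s ++ t)))
   (`[< V (row_of_seq (i + k) (s ++ t)) >] : nat))%N =
   leaf_count (fun t => E (s ++ t))
       [set w : 'rV[K]_k | V (row_mx (row_of_seq i s) w)].
  by rewrite leaf_countE; apply: eq_bigr => t _; rewrite row_of_seq_cat.
(* No leaf of [V] lies above a point outside the projection of [V]. *)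
case: asboolP => // nV; rewrite leaf_countE big1 // => t _.
apply/eqP; rewrite eqb0; apply/asboolPn => Vt; apply: nV.
by exists (row_mx (row_of_seq i s) (row_of_seq k t)); rewrite ?row_mxKl.
Qed.

End LeafCount.

(** * Counting polynomials at integer arguments *)

(** Substitutes [e] for oo and [c(e)] for aleph_0: a constant [c = k] gives the reading of
    [cp_prec], and [c = 'X - k'] that of [cp_succ]. *)
Definition cp_eval (c : {poly int}) (e : nat) (p : cpoly) : int := p.[c].[e%:Z].

Lemma cp_evalD c e p q : cp_eval c e (p + q) = cp_eval c e p + cp_eval c e q.
Proof. by rewrite /cp_eval !hornerD. Qed.

Lemma cp_evalB c e p q : cp_eval c e (p - q) = cp_eval c e p - cp_eval c e q.
Proof. by rewrite /cp_eval !(hornerD, hornerN). Qed.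

Lemma cp_evalM c e p q : cp_eval c e (p * q) = cp_eval c e p * cp_eval c e q.
Proof. by rewrite /cp_eval !hornerM. Qed.

Lemma cp_eval_nat c e n : cp_eval c e n%:R = n%:Z.
Proof.
rewrite /cp_eval -(rmorph_nat (@polyC {poly int})) -(rmorph_nat (@polyC int)).
by rewrite !hornerC natz.
Qed.

Lemma cp_eval_infty c e : cp_eval c e cp_infty = e%:Z.
Proof. by rewrite /cp_eval hornerC hornerX. Qed.

Lemma cp_eval_aleph c e : cp_eval c e cp_aleph = c.[e%:Z].
Proof. by rewrite /cp_eval hornerX. Qed.

(** * Bounds on the leaf count, axiom by axiom *)

Section CountBounds.
Variables (K : numFieldType) (c d : {poly int}).

(* At the shrinking end [l] may be negative (for instance oo - aleph_0 - j with
   j > k'), and products of negative values would spoil [l <= x]; the last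
   clause gives [x] the room needed to dominate [- l] in a fibration. *)
Definition count_bounds N (V : set 'rV[K]_N) (p : cpoly) : Prop :=
  forall b : nat, exists R, forall e E, tree_over e R E N ->
    let x : int := leaf_count E V in
    let u := cp_eval c e p in let l := cp_eval d e p in
    [/\ x <= u, l <= x, finite_set V -> u = x /\ l = x &
        infinite_set V -> b%:Z <= x + l].

Lemma count_bounds_fset N (A : {fset 'rV[K]_N}) :
  count_bounds [set` A] (#|` A|%fset)%:R.
Proof.
move=> b; have [R hR] := mem_rows A; exists R => e E hE /=.
rewrite (leaf_count_fset hE (hR _ _ hE)).
by rewrite !cp_eval_nat; split=> // -[].
Qed.

Lemma leaf_count_setT e R E : tree_over e R E 1 ->
  leaf_count E [set: 'rV[K]_1] = e.
Proof.
case=> _ <- _ _; rewrite leaf_countE big_allpairs_dep /= -sum1_size.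
by apply: eq_bigr => a _; rewrite big_seq1 asboolT.
Qed.

Lemma count_bounds_setT : count_bounds [set: 'rV[K]_1] cp_infty.
Proof.
move=> b; have [R hR] : exists R : seq K -> seq K, forall e E,
    tree_over e R E 1 ->
    infinite_set [set: 'rV[K]_1] -> (b <= e)%N.
  have [fin|inf] := pselect (finite_set [set: 'rV[K]_1]).
    by exists (fun=> [::]).
  have [A _ bA] := infinite_set_fset b inf.
  have [R hR] := mem_rows A; exists R => e E hE _; apply: leq_trans bA _.
  by rewrite -(leaf_count_setT hE) (leaf_count_ge hE (hR _ _ hE)).
exists R => e E hE /=; rewrite (leaf_count_setT hE) !cp_eval_infty.
by split=> // inf; have := hR _ _ hE inf; lia.
Qed.

Lemma count_boundsU N (V W : set 'rV[K]_N) p q : V `&` W = set0 ->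
  count_bounds V p -> count_bounds W q -> count_bounds (V `|` W) (p + q).
Proof.
move=> VW hV hW b; have [RV {}hV] := hV b; have [RW {}hW] := hW b.
exists (fun s => RV s ++ RW s) => e E /tree_over_catr[/hV/= hV1 /hW/= hW1].
rewrite leaf_countU // !cp_evalD PoszD finite_setU.
case: hV1 => uV lV fV iV; case: hW1 => uW lW fW iW; split; [lia|lia| |].
  by case=> /fV[-> ->] /fW[-> ->].
(* A finite part has [l = x], so it adds [2x >= 0] to [x + l]; an infinite part adds at least [b],
   and one of the two is infinite. *)
move=> inf; have [finV|/iV bV] := pselect (finite_set V);
  have [finW|/iW bW] := pselect (finite_set W); last by lia.
- by case: inf.
- by have [] := fV finV; lia.
- by have [] := fW finW; lia.
Qed.

Lemma count_bounds_diff N (V : set 'rV[K]_N) (A : {fset 'rV[K]_N}) p :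
  V `&` [set` A] = set0 -> count_bounds (V `|` [set` A]) p ->
  count_bounds V (p - (#|` A|%fset)%:R).
Proof.
(* Removing [A], all of whose points are made leaves, lowers both [x] and [l] by its size; the
   margin therefore exceeds [b] by twice that size. *)
move=> VA hVA b; have [R {}hVA] := hVA (b + #|` A| + #|` A|)%N.
have [RA hA] := mem_rows A.
exists (fun s => R s ++ RA s) => e E /tree_over_catr[/hVA/= + hE].
rewrite leaf_countU // (leaf_count_fset hE (hA _ _ hE)).
rewrite !cp_evalB !cp_eval_nat PoszD finite_setU.
move: (#|` A|%fset) => n [u l f i]; split; [lia|lia| |].
  by move=> finV; have [|-> ->] := f; [split | lia].
move=> infV; have := i (fun h => infV h.1); rewrite !PoszD; lia.
Qed.

(** With [y] leaves in the base and fiber counts between [Pl] and [Pu], [x] lies between [y * Pl]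
    and [y * Pu]. Since [Pu >= 0], [y <= Qu] gives the upper bound. The lower bound follows likewise
    from [Ql <= y] if [Pl >= 0]. If [Pl < 0], every non-empty fiber is infinite and has at least
    [b - Pl] leaves, while [- Ql <= y]; so [x >= - y * Pl >= Pl * Ql]. *)
Lemma count_bounds_fibration i k (V : set 'rV[K]_(i + k)) p q :
  (forall a : 'rV[K]_i, (lsubmx @` V) a ->
     count_bounds [set w : 'rV[K]_k | V (row_mx a w)] p) ->
  count_bounds (lsubmx @` V) q -> count_bounds V (p * q).
Proof.
move=> hF hQ b; have [RQ {}hQ] := hQ b.
(* For empty [V] nothing is known about [p], but both values of [q] are 0. *)
have [V0|/set0P[v0 Vv0]] := eqVneq V set0.
  exists (fun s => RQ s) => e E /tree_over_cat[/hQ/= + _].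
  rewrite V0 image_set0 !leaf_countE.
  rewrite !big1 => [|s _|s _]; try by rewrite asboolF.
  case=> _ _ /(_ (finite_set0 _))[q0 q0'] _; rewrite !cp_evalM q0 q0' !mulr0.
  by split=> // -[]; exact: finite_set0.
have /choice[RF {}hF] (a : 'rV[K]_i) : exists R : seq K -> seq K,
    (lsubmx @` V) a ->
    forall e E, tree_over e R E k ->
    let x : int := leaf_count E [set w : 'rV[K]_k | V (row_mx a w)] in
    let u := cp_eval c e p in let l := cp_eval d e p in
    [/\ x <= u, l <= x, finite_set [set w | V (row_mx a w)] -> u = x /\ l = x &
        infinite_set [set w | V (row_mx a w)] -> b%:Z <= x + l].
  have [Va|] := pselect ((lsubmx @` V) a); last by exists (fun=> [::]).
  by have [R hR] := hF a Va b; exists R.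
have [RB hB] : exists R : seq K -> seq K, forall e E, tree_over e R E (i + k) ->
    infinite_set V -> (b <= leaf_count E V)%N.
  have [fin|inf] := pselect (finite_set V); first by exists (fun=> [::]).
  have [A AV bA] := infinite_set_fset b inf.
  have [R hR] := mem_rows A; exists R => e E hE _; apply: leq_trans bA _.
  exact: leaf_count_ge hE (hR _ _ hE) AV.
(* One point of the base is forced to be a leaf: this gives [1 <= y] and a fiber from which to read
   off properties of [p]. *)
have [RP hP] := mem_rows [fset lsubmx v0]%fset.
(* Below depth [i], [take i s] is the base point under the node [s], and [drop i s] its path inside
   the tree of the fiber. *)
exists (fun s => RQ s ++ (RP s ++ (RB s ++
  RF (row_of_seq i (take i s)) (drop i s)))) => e E.
move=> /tree_over_catr[/tree_over_cat[/hQ{}hQ _]].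
move=> /tree_over_catr[/tree_over_cat[hEi _]].
move=> /tree_over_catr[/hB{}hB /tree_over_cat[_ hEk]] /=.
have {hP}y1 : (1 <= leaf_count E (lsubmx @` V))%N.
  apply: leq_trans (leaf_count_ge hEi (hP _ _ hEi) _); first by rewrite cardfs1.
  by move=> v /=; rewrite inE => /eqP ->; exists v0.
have {}hF s : s \in leaves i E -> `[< (lsubmx @` V) (row_of_seq i s) >] ->
    let W := [set w : 'rV[K]_k | V (row_mx (row_of_seq i s) w)] in
    let x : int := leaf_count (fun t => E (s ++ t)) W in
    let u := cp_eval c e p in let l := cp_eval d e p in
    [/\ x <= u, l <= x, finite_set W -> u = x /\ l = x &
        infinite_set W -> b%:Z <= x + l].
  move=> sE /asboolP Vs; apply: (hF _ Vs e (fun t => E (s ++ t))).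
  refine (tree_over_sub _ (hEk s sE)) => t a /=; have si := leaves_size sE.
  by rewrite take_size_cat // drop_size_cat.
have fin_fiber (a : 'rV[K]_i) : finite_set V ->
    finite_set [set w : 'rV[K]_k | V (row_mx a w)].
  move=> finV; apply: sub_finite_set (finite_image rsubmx finV) => w Vw.
  by exists (row_mx a w); rewrite ?row_mxKr.
have [s0 s0E Vs0] : exists2 s, s \in leaves i E &
    `[< (lsubmx @` V) (row_of_seq i s) >].
  by move: y1; rewrite /leaf_count /rows count_map -has_count => /hasP.
have yE : leaf_count E (lsubmx @` V) =
    count (fun s => `[< (lsubmx @` V) (row_of_seq i s) >]) (leaves i E).
  by rewrite /leaf_count /rows count_map.
have [uQ lQ fQ iQ] := hQ.
rewrite !cp_evalM.
have Up : 0 <= cp_eval c e p by have [+ _ _ _] := hF _ s0E Vs0; lia.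
have xU : (leaf_count E V)%:Z <=
    (leaf_count E (lsubmx @` V))%:Z * cp_eval c e p.
  rewrite leaf_count_fibration yE; apply: ger_sum_count => s sE Vs.
  by case: (hF s sE Vs).
have xL : (leaf_count E (lsubmx @` V))%:Z * cp_eval d e p <=
    (leaf_count E V)%:Z.
  rewrite leaf_count_fibration yE; apply: ler_sum_count => s sE Vs.
  by case: (hF s sE Vs).
have xN : cp_eval d e p < 0 ->
    (leaf_count E (lsubmx @` V))%:Z * (b%:Z - cp_eval d e p) <=
    (leaf_count E V)%:Z.
  move=> neg; rewrite leaf_count_fibration yE.
  apply: ler_sum_count => s sE Vs.
  have [_ _ fp ip] := hF s sE Vs.
  have [/fp[_ lx]|/ip] := pselect (finite_set
    [set w : 'rV[K]_k | V (row_mx (row_of_seq i s) w)]).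
    by move: neg; rewrite lx.
  by rewrite lerBlDr.
move: xU xL xN uQ lQ fQ iQ y1; set x := leaf_count E V.
set y := leaf_count E _; set Pu := cp_eval c _ p; set Pl := cp_eval d _ p.
set Qu := cp_eval c _ q; set Ql := cp_eval d _ q => xU xL xN uQ lQ fQ iQ y1.
have yQ : - Ql <= y%:Z.
  have [/fQ[_]|/iQ] := pselect (finite_set (lsubmx @` V)); lia.
have b0 : 0 <= b%:Z by [].
split.
- by apply: le_trans xU _; rewrite mulrC ler_wpM2l.
- have [Pl0|Pl0] := leP 0 Pl.
    by apply: le_trans xL; rewrite mulrC ler_wpM2r.
  by have := xN Pl0; nia.
- move=> finV; have [-> ->] := fQ (finite_image _ finV).
  have [_ _ /(_ (fin_fiber _ finV))[uE lE] _] := hF _ s0E Vs0.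
  have Ple : Pl = Pu by rewrite /Pl /Pu uE lE.
  by have := xU; have := xL; rewrite Ple; lia.
move=> infV; have bx : b%:Z <= x%:Z by have := hB infV; lia.
(* If [Pl < 0], [Ql <= y] leaves [x + Pl * Ql >= y * b >= b]. If [Pl = 0] or the base is finite, the
   [b] prescribed points of [V] suffice. Otherwise [x + Pl * Ql >= Pl * (y + Ql) >= Pl * b >= b]. *)
have [Pl0|Pl0] := leP 0 Pl; last by have := xN Pl0; nia.
have [/fQ[_ QlE]|/iQ bQ] := pselect (finite_set (lsubmx @` V)).
  by rewrite QlE; nia.
have [->|Pln0] := eqVneq Pl 0; first by rewrite mul0r addr0.
have : Pl * b%:Z <= Pl * (y%:Z + Ql) by rewrite ler_wpM2l.
have : b%:Z <= Pl * b%:Z by rewrite ler_peMl // -gtz0_ge1 lt_neqAle eq_sym Pln0.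
by rewrite mulrDr [Pl * y%:Z]mulrC; lia.
Qed.

End CountBounds.

(* A line is a fibration over K^1 or over a point, according to whether its
   direction has a non-zero first coordinate, so no separate count is needed. *)
Lemma count_bounds_line (K : numFieldType) (c d : {poly int}) N
    (V : set 'rV[K]_N) :
  affine_line V -> count_bounds c d V cp_infty.
Proof.
elim: N V => [|N IH] V [a [v [v0 ->]]].
  by case/eqP: v0; apply/rowP; case.
have cb1 n (w : 'rV[K]_n) : count_bounds c d [set w] 1.
  rewrite -(_ : [set` [fset w]%fset] = [set w]); last first.
    by apply/seteqP; split=> u /=; rewrite inE => /eqP.
  by have := count_bounds_fset c d [fset w]%fset; rewrite cardfs1.
pose a0 : 'rV[K]_1 := lsubmx (a : 'rV_(1 + N)).
pose a1 : 'rV[K]_N := rsubmx (a : 'rV_(1 + N)).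
pose v0' : 'rV[K]_1 := lsubmx (v : 'rV_(1 + N)).
pose v1 : 'rV[K]_N := rsubmx (v : 'rV_(1 + N)).
have vE : v = row_mx v0' v1 by rewrite hsubmxK.
have tE t : a + t *: v = row_mx (a0 + t *: v0') (a1 + t *: v1).
  by rewrite -add_row_mx -scale_row_mx !hsubmxK.
have [v00|v0n] := eqVneq v0' 0.
  rewrite -[cp_infty]mulr1; apply: (@count_bounds_fibration K c d 1 N).
    move=> _ [_ [t _ <-] <-]; apply: IH; exists a1, v1.
    split; first by apply: contra_neq v0; rewrite vE v00 => ->; rewrite row_mx0.
    rewrite tE row_mxKl v00 scaler0 addr0.
    apply/seteqP; split=> [w [s _]|_ [s _ <-]] /=.
      rewrite tE v00 scaler0 addr0 => h; have := congr1 (@rsubmx K 1 1 N) h.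
      by rewrite !row_mxKr => <-; exists s.
    by exists s => //; rewrite tE v00 scaler0 addr0.
  rewrite (_ : _ @` _ = [set a0]) //.
  apply/seteqP; split=> [_ [_ [t _ <-] <-]|_ ->] /=.
    by rewrite tE row_mxKl v00 scaler0 addr0.
  by exists a; [exists 0 => //; rewrite scale0r addr0 | ].
rewrite -[cp_infty]mul1r; apply: (@count_bounds_fibration K c d 1 N).
  move=> _ [_ [t _ <-] <-]; rewrite tE row_mxKl.
  rewrite (_ : [set w | _] = [set a1 + t *: v1]) //.
  apply/seteqP; split=> [w [s _]|_ ->] /=; last by exists t.
  rewrite tE => h; have := congr1 (@rsubmx K 1 1 N) h; rewrite !row_mxKr => <-.
  have := congr1 (@lsubmx K 1 1 N) h; rewrite !row_mxKl => /addrI/eqP.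
  rewrite -subr_eq0 -scalerBl scaler_eq0 (negPf v0n) orbF subr_eq0.
  by move=> /eqP ->.
rewrite (_ : _ @` _ = setT); first exact: count_bounds_setT.
apply/seteqP; split=> // b _.
have v00 : v0' ord0 ord0 != 0.
  apply: contra_neq v0n => h; apply/rowP => j.
  by rewrite (ord1 j : j = ord0) h mxE.
have solve (x y z : 'rV[K]_1) : y ord0 ord0 != 0 ->
    x + ((z ord0 ord0 - x ord0 ord0) / y ord0 ord0) *: y = z.
  move=> h; apply/rowP => j.
  by rewrite (ord1 j : j = ord0) !mxE divfK // addrC subrK.
exists (a + ((b ord0 ord0 - a0 ord0 ord0) / v0' ord0 ord0) *: v).
  by eexists.
by rewrite tE row_mxKl solve.
Qed.

(** * Complements of countable sets, and the bounds for all counting polynomials *)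

Lemma infinite_setC_countable (K : numFieldType) (M : set 'rV[K]_1) :
  ~ countable [set: K] -> countable M -> infinite_set (~` M).
Proof.
move=> uncK cM fM; apply: uncK.
have -> : [set: K] = (fun v : 'rV[K]_1 => v ord0 ord0) @`
    \bigcup_b (if b then M else ~` M).
  apply/seteqP; split=> // a _; exists (const_mx a); last by rewrite mxE.
  by have [Ma|Ma] := pselect (M (const_mx a)); [exists true | exists false].
apply: sub_countable (card_image_le _ _) _; apply: bigcup_countable => //.
by case=> // _; exact: finite_set_countable.
Qed.

(** The [k] leaves forced into [M] leave at most [e - k] outside, and at least [k' = e - (e - k')]
    are forced outside; these are the two values of oo - aleph_0. Forcing [maxn b k'] leaves outside
    also gives the last clause. *)
Lemma count_bounds_cocountable (K : numFieldType) (M : set 'rV[K]_1) k k' :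
  ~ countable [set: K] -> countable M -> infinite_set M ->
  count_bounds k%:R ('X - k'%:R) (~` M) (cp_infty - cp_aleph).
Proof.
move=> uncK cM infM b.
have [A AM kA] := infinite_set_fset k infM.
have infCM := infinite_setC_countable uncK cM.
have [B BM bB] := infinite_set_fset (maxn b k') infCM.
have [RA hA] := mem_rows A; have [RB hB] := mem_rows B.
exists (fun s => RA s ++ RB s) => e E /tree_over_catr[hEA hEB] /=.
have := leaf_count_ge hEA (hA _ _ hEA) AM.
have := leaf_count_ge hEB (hB _ _ hEB) BM.
have := leaf_countU E (setICr M); rewrite setUv (leaf_count_setT hEA).
move: kA bB; rewrite !cp_evalB !cp_eval_infty !cp_eval_aleph.
rewrite -!(rmorph_nat (@polyC int)) hornerD hornerN !hornerC hornerX !natz.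
rewrite geq_max.
move: (#|` A|%fset) (#|` B|%fset) => nA nB kA /andP[bB kB] eE BE AE.
by split; [lia|lia|move=> /infCM|move=> _; lia].
Qed.

Lemma acp_count_bounds (K : numFieldType) N (V : set 'rV[K]_N) p k k' :
  ~ countable [set: K] -> acp V p -> count_bounds k%:R ('X - k'%:R) V p.
Proof.
move=> uncK; elim=> {N V p}.
- by move=> N A; exact: count_bounds_fset.
- by move=> N V; exact: count_bounds_line.
- by move=> N V W p q VW _ hV _ hW; exact: count_boundsU.
- by move=> N V A p VA _; exact: count_bounds_diff.
- by move=> i j V p q _ hF _ hQ; exact: count_bounds_fibration.
- by move=> M cM iM; exact: count_bounds_cocountable.
Qed.

(** * Comparison of two counting polynomials over an uncountable field *)

Lemma acp_prec_succ_le (K : numFieldType) N (V : set 'rV[K]_N) p1 p2 q1 q2 :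
  ~ countable [set: K] -> acp V p1 -> acp V p2 ->
  cp_prec p1 q1 -> cp_succ p2 q2 ->
  exists e0 : nat, forall e : nat, (e0 <= e)%N -> q2.[e%:Z] <= q1.[e%:Z].
Proof.
move=> uncK V1 V2 [k <-] [k' <-].
have [R1 h1] := acp_count_bounds k k' uncK V1 0.
have [R2 h2] := acp_count_bounds k k' uncK V2 0.
have [e0 he0] := tree_over_exists (fun s => R1 s ++ R2 s) N uncK.
exists e0 => e /he0[E /tree_over_catr[/h1[u _ _ _] /h2[_ l _ _]]].
exact: le_trans l u.
Qed.

(** A countable set has Lebesgue measure 0, the unit interval has measure 1. *)
Lemma uncountable_realType (R : realType) : ~ countable [set: R].
Proof.
move=> cR; have c01 : countable `[0 : R, 1].
  exact: sub_countable (subset_card_le (@subsetT _ _)) cR.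
have := countable_lebesgue_measure0 c01.
rewrite lebesgue_measure_itv /= lte_fin ltr01 oppr0 adde0 => /eqP.
by rewrite eqe oner_eq0.
Qed.

Lemma uncountable_complex (R : realType) : ~ countable [set: R[i]].
Proof.
move=> cC; apply: (@uncountable_realType R).
have -> : [set: R] = @complex.Re R @` [set: R[i]].
  by apply/seteqP; split=> // x _; exists (x%:C)%C.
exact: sub_countable (card_image_le _ _) cC.
Qed.

Lemma eventually_lt_horner (R : realType) (q q' : {poly int}) :
  eventually_lt R (map_poly intr q) (map_poly intr q') ->
  exists e0 : nat, forall e : nat, (e0 <= e)%N -> q.[e%:Z] < q'.[e%:Z].
Proof.
case=> x0 hx; exists (Num.bound `|x0|) => e he.
have /hx : x0 < e%:R.
  apply: le_lt_trans (ler_norm x0) _.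
  by apply: lt_le_trans (archi_boundP (normr_ge0 x0)) _; rewrite ler_nat.
have E (p : {poly int}) :
    (map_poly ratr (map_poly intr p : {poly rat})).[e%:R] = (p.[e%:Z])%:~R :> R.
  rewrite -(ratr_nat R) horner_map -[X in _.[X]](_ : (e%:Z)%:~R = e%:R) //.
  by rewrite horner_map /= ratr_int.
by rewrite !E ltr_int.
Qed.

Theorem proposition4p4 (R : realType) (n m : nat) (F : merofield R[i] n)
    (lt : rel (jetvar m n)) (hlt : orderly_ranking lt)
    (zeta : 'rV[R[i]]_n) (S1 S2 : ar_system m F)
    (hol1 : holomorphic_coeffs S1 zeta) (hol2 : holomorphic_coeffs S2 zeta)
    (hsub : Sol zeta S1 `<=` Sol zeta S2)
    (c1 c2 : nat -> cpoly)
    (hc1 : counting_sequence lt zeta S1 c1)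
    (hc2 : counting_sequence lt zeta S2 c2) :
  (exists (l : nat) (q1 q2 : {poly int}),
     [/\ cp_prec (c1 l) q1,
         eventually_lt R (map_poly intr q1) (map_poly intr q2) &
         cp_succ (c2 l) q2]) ->
  Sol zeta S1 <> Sol zeta S2.
Proof.
move=> [l [q1 [q2 [prec lt12 succ]]]] eqS.
have [_ acp1] := hc1 l; have [_ acp2] := hc2 l.
have eqSl : Sol_upto lt zeta S1 l = Sol_upto lt zeta S2 l.
  by rewrite /Sol_upto eqS.
rewrite eqSl in acp1.
have [e1 h1] := acp_prec_succ_le (@uncountable_complex R) acp1 acp2 prec succ.
have [e2 h2] := eventually_lt_horner lt12.
(* At an arity [e] beyond both thresholds, [q2(e) <= q1(e) < q2(e)]. *)
have := h2 _ (leq_maxr e1 e2).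
by rewrite ltNge h1 // leq_maxl.
Qed.
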